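(* Let $T \in M_n(\mathbb{C})$. Then $T$ is UET (unitarily equivalent to its transpose) if and only if $T$ is unitarily equivalent to a direct sum of matrices each of which is of one of the following three types (some of the types may be absent): (I) irreducible complex symmetric matrices; (II) irreducible skew-Hamiltonian matrices (such matrices are necessarily $8\times 8$ or larger); (III) $2d\times 2d$ block matrices of the form $\begin{pmatrix} A & 0\\ 0 & A^t\end{pmatrix}$, where $A \in M_d(\mathbb{C})$ is irreducible and is neither UECSM nor UESHM (such matrices are necessarily $6\times 6$ or larger). Moreover, the unitary orbits of the three classes (I), (II), (III) are pairwise disjoint, i.e., no matrix of one of these types is unitarily equivalent to a matrix of a different type.
   Context: $M_n(\mathbb{C})$ denotes the $n\times n$ complex matrices, $T^t$ the (entrywise, non-conjugated) transpose and $T^*$ the conjugate transpose. Two matrices $A,B\in M_n(\mathbb{C})$ are unitarily equivalent, $A\cong B$, if $A = UBU^*$ for some unitary $U\in M_n(\mathbb{C})$. $T$ is UET if $T\cong T^t$. A complex symmetric matrix is a square complex matrix with $T=T^t$; $T$ is UECSM if it is unitarily equivalent to a complex symmetric matrix. A $2d\times 2d$ matrix is skew-Hamiltonian if it has the form $\begin{pmatrix} A & B\\ D & A^t\end{pmatrix}$ with $A,B,D\in M_d(\mathbb{C})$, $B^t=-B$, $D^t=-D$; $T$ is UESHM if it has even size and is unitarily equivalent to a skew-Hamiltonian matrix. A matrix $T\in M_n(\mathbb{C})$ is irreducible if it is not unitarily equivalent to a direct sum $A\oplus B$ with $A\in M_d(\mathbb{C})$, $B\in M_{n-d}(\mathbb{C})$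 for some $1\le d<n$; equivalently, the only normal matrices commuting with $T$ are scalar multiples of the identity. *)

(* Defs.v *)
From mathcomp Require Import all_boot all_order all_algebra.
From mathcomp Require Import complex.
From mathcomp Require Import reals.

Set Implicit Arguments.
Unset Strict Implicit.
Unset Printing Implicit Defensive.

Import GRing.Theory Num.Theory.
Local Open Scope ring_scope.
Local Open Scope sesquilinear_scope.

Section UnitaryEquivalence.

Variable C : numClosedFieldType.

Definition unitary_equiv n (A B : 'M[C]_n) : Prop :=
  exists2 U : 'M[C]_n, U \is unitarymx & A = U *m B *m U^t*.

Definition UET n (T : 'M[C]_n) : Prop := unitary_equiv T T^T.

Definition complex_symmetric n (T : 'M[C]_n) : Prop := T = T^T.

Definition UECSM n (T : 'M[C]_n) : Prop :=
  exists2 S : 'M[C]_n, complex_symmetric S & unitary_equiv T S.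

(* The equation [e] forces the size to be even. Here and below, [castmx (e, e)]
   only transports a block matrix to size [n]; it does not change entries. *)
Definition skew_hamiltonian n (T : 'M[C]_n) : Prop :=
  exists (d : nat) (e : (d + d)%N = n) (A B D : 'M[C]_d),
    [/\ B^T = - B, D^T = - D & T = castmx (e, e) (block_mx A B D A^T)].

Definition UESHM n (T : 'M[C]_n) : Prop :=
  exists2 S : 'M[C]_n, skew_hamiltonian S & unitary_equiv T S.

(* The 0 x 0 matrix is not regarded as irreducible. *)
Definition irreducible_mx n (T : 'M[C]_n) : Prop :=
  (0 < n)%N /\
  ~ exists (d1 d2 : nat) (e : (d1 + d2)%N = n) (A : 'M[C]_d1) (B : 'M[C]_d2),
      [/\ (0 < d1)%N, (0 < d2)%N
        & unitary_equiv T (castmx (e, e) (block_mx A 0 0 B))].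

Definition typeI n (T : 'M[C]_n) : Prop :=
  irreducible_mx T /\ complex_symmetric T.

Definition typeII n (T : 'M[C]_n) : Prop :=
  irreducible_mx T /\ skew_hamiltonian T.

Definition typeIII n (T : 'M[C]_n) : Prop :=
  exists (d : nat) (e : (d + d)%N = n) (A : 'M[C]_d),
    [/\ irreducible_mx A, ~ UECSM A, ~ UESHM A
      & T = castmx (e, e) (block_mx A 0 0 A^T)].

Definition unitary_equiv_direct_sum (P : forall m, 'M[C]_m -> Prop)
    n (T : 'M[C]_n) : Prop :=
  exists (k : nat) (p : 'I_k -> nat) (e : (\sum_i p i)%N = n)
         (B : forall i, 'M[C]_(p i)),
    (forall i, P (p i) (B i)) /\
    unitary_equiv T (castmx (e, e) (\mxdiag_i B i)).

End UnitaryEquivalence.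

(* Main.v *)
(* T splits orthogonally into irreducible pieces, and unitary equivalence allows
   cancelling an irreducible summand A. If T is UET, then A^T is again a summand
   of T. If A is not UET, A^T sits in the complement of A, which gives a block
   of type (III). If A = U A^T U^*, Schur's lemma forces U^T = U or U^T = -U; a
   factorisation U = V V^T, resp. U = V J V^T, with V unitary then turns A into a
   complex symmetric, resp. skew-Hamiltonian, matrix, and both signs cannot
   occur at once.

   For the size bound in (II), conjugate a skew-Hamiltonian matrix, by a unitary
   commuting with the quaternionic structure, so that its Hermitian part is
   diagonal. What remains is a d x d matrix of essentially quaternionic 2 x 2
   tiles, and for d <= 3 a gauge transformation along the edges of a star,
   whose only obstruction is the holonomy of one triangle, produces a
   nonscalar element of the commutant. *)
Require Import Defs.
From mathcomp Require Import all_boot all_order all_algebra.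
From mathcomp Require Import complex.
From mathcomp Require Import reals.
From mathcomp Require Import boolp ring zify.

Set Implicit Arguments.
Unset Strict Implicit.
Unset Printing Implicit Defensive.

Import Order.TTheory GRing.Theory Num.Theory.

Local Open Scope ring_scope.
Local Open Scope sesquilinear_scope.

Local Notation "A ⊕ B" := (block_mx A 0 0 B) (at level 50).
Local Notation conjm := (map_mx Num.conj).

(** * Adjoints and unitary matrices *)

Section Adjoint.
Variable C : numClosedFieldType.

Lemma adjmxM m n p (A : 'M[C]_(m, n)) (B : 'M_(n, p)) :
  (A *m B)^t* = B^t* *m A^t*.
Proof. by rewrite trmx_mul map_mxM. Qed.

Lemma adjmxD m n (A B : 'M[C]_(m, n)) : (A + B)^t* = A^t* + B^t*.
Proof. by rewrite linearD /= map_mxD. Qed.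

Lemma adjmxZ m n a (A : 'M[C]_(m, n)) : (a *: A)^t* = a^* *: A^t*.
Proof. by rewrite linearZ /= map_mxZ. Qed.

Lemma adjmx1 n : (1%:M : 'M[C]_n)^t* = 1%:M.
Proof. by rewrite trmx1 map_mx1. Qed.

Lemma adjmx0 m n : (0 : 'M[C]_(m, n))^t* = 0.
Proof. by rewrite trmx0 map_mx0. Qed.

Lemma adjmx_block m1 m2 n1 n2 (A : 'M[C]_(m1, n1)) B D (E : 'M_(m2, n2)) :
  (block_mx A B D E)^t* = block_mx (A^t*) (D^t*) (B^t*) (E^t*).
Proof. by rewrite tr_block_mx map_block_mx. Qed.

Lemma mulmx_adj_eq0 m n (A : 'M[C]_(m, n)) : A *m A^t* = 0 -> A = 0.
Proof.
move=> AA0; apply/row_matrixP => i; rewrite row0; apply/eqP.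
have := congr1 (fun M : 'M_m => M i i) AA0; rewrite /= !mxE => sum0.
rewrite -(dnorm_eq0 (@dotmx C n)) -[X in X == _]/(dotmx _ _) dotmxE mxE.
rewrite -[X in _ == X]sum0; apply/eqP.
by apply: eq_bigr => j _; rewrite !mxE.
Qed.

Lemma unitarymx_square m n (V : 'M[C]_(m, n)) :
  V \is unitarymx -> m = n -> V^t* *m V = 1%:M.
Proof. by move=> Vu emn; rewrite -[V^t*]mul1mx mulmxKtV. Qed.

Lemma unitarymx_leq m n (V : 'M[C]_(m, n)) : V \is unitarymx -> (m <= n)%N.
Proof. by move=> /mxrank_unitary <-; exact: rank_leq_col. Qed.

(** For a rectangular matrix, [unitarymx] means orthonormal rows; Gram-Schmidt on a basis of the
    orthogonal complement of the rows of [V] supplies [Q]. *)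
Lemma exists_orthogonal_complement m n (V : 'M[C]_(m, n)) :
  V \is unitarymx ->
  exists k (Q : 'M[C]_(k, n)), (m + k)%N = n /\ col_mx V Q \is unitarymx.
Proof.
move=> Vu; pose W := (orthomx Num.conj (mx_of_hermitian (hermitian1mx _)) V).
exists (\rank W), (schmidt (row_base W)); split.
  by rewrite -{1}(mxrank_unitary Vu) add_rank_ortho.
have QV : schmidt (row_base W) *m V^t* = 0.
  apply/orthomx1P; rewrite eqmx_schmidt_free ?row_base_free //.
  by rewrite eq_row_base.
have VQ : V *m (schmidt (row_base W))^t* = 0.
  by rewrite -[LHS]trmxCK adjmxM trmxCK QV adjmx0.
apply/unitarymxP; rewrite tr_col_mx map_row_mx mul_col_row VQ QV.
rewrite (unitarymxP Vu) (unitarymxP _) -?scalar_mx_block //.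
by rewrite schmidt_unitarymx ?rank_leq_col.
Qed.

End Adjoint.

(** * Intertwiners and unitary equivalence across sizes *)

(** The second equation makes the notion stable under adjoints, so that stable subspaces arising
    from intertwiners are reducing. *)
Definition intertwines (C : numClosedFieldType) m n
    (V : 'M[C]_(m, n)) (S : 'M_m) (T : 'M_n) : Prop :=
  S *m V = V *m T /\ S^t* *m V = V *m T^t*.

(** The rows of [V] form an orthonormal basis of a reducing subspace on which [T], acting on row
    vectors, is given by [S]. *)
Definition summand (C : numClosedFieldType) m n (S : 'M[C]_m) (T : 'M[C]_n) :=
  exists2 V : 'M[C]_(m, n), V \is unitarymx & intertwines V S T.

(* Unitary equivalence of matrices whose sizes are only propositionally equal,
   so that no casts are needed. *)
Definition equivmx (C : numClosedFieldType) m n (S : 'M[C]_m) (T : 'M[C]_n) :=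
  m = n /\ summand S T.

Section Equivalence.
Variable C : numClosedFieldType.

Lemma intertwines_adj m n (V : 'M[C]_(m, n)) S T :
  intertwines V S T -> intertwines (V^t*) T S.
Proof.
move=> [VST VST']; split.
  by rewrite -[T in LHS]trmxCK -adjmxM -VST' adjmxM trmxCK.
by rewrite -!adjmxM VST.
Qed.

Lemma intertwinesM m n p (V : 'M[C]_(m, n)) (W : 'M_(n, p)) S T U :
  intertwines V S T -> intertwines W T U -> intertwines (V *m W) S U.
Proof.
move=> [VST VST'] [WTU WTU']; split; first by rewrite mulmxA VST -!mulmxA WTU.
by rewrite mulmxA VST' -!mulmxA WTU'.
Qed.

Lemma intertwines_unitary m n (V : 'M[C]_(m, n)) S T :
  V \is unitarymx -> m = n -> S *m V = V *m T -> intertwines V S T.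
Proof.
move=> Vu emn VST; split=> //.
have VV := unitarymx_square Vu emn.
have -> : T = V^t* *m S *m V by rewrite -mulmxA VST mulmxA VV mul1mx.
by rewrite !adjmxM trmxCK !mulmxA (unitarymxP Vu) mul1mx.
Qed.

Lemma summand_trans m n p (S : 'M[C]_m) (T : 'M_n) (U : 'M_p) :
  summand S T -> summand T U -> summand S U.
Proof.
move=> [V Vu VST] [W Wu WTU]; exists (V *m W).
  exact: mul_unitarymx.
exact: intertwinesM VST WTU.
Qed.

Lemma summand_leq m n (S : 'M[C]_m) (T : 'M_n) : summand S T -> (m <= n)%N.
Proof. by case=> V /unitarymx_leq. Qed.

Lemma equivmx_refl n (T : 'M[C]_n) : equivmx T T.
Proof.
split=> //; exists 1%:M; first by rewrite qualifE /= adjmx1 mulmx1.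
by split; rewrite mulmx1 mul1mx.
Qed.

Lemma equivmx_sym m n (S : 'M[C]_m) (T : 'M_n) : equivmx S T -> equivmx T S.
Proof.
case=> emn [V Vu VST]; split=> //; exists (V^t*); last exact: intertwines_adj.
by apply/unitarymxP; rewrite trmxCK unitarymx_square.
Qed.

Lemma equivmx_trans m n p (S : 'M[C]_m) (T : 'M_n) (U : 'M_p) :
  equivmx S T -> equivmx T U -> equivmx S U.
Proof.
move=> [emn ST] [enp TU]; split; first by rewrite emn.
exact: summand_trans ST TU.
Qed.

Lemma unitary_equivE n (S T : 'M[C]_n) : unitary_equiv S T <-> equivmx S T.
Proof.
split=> [[U Uu ->]|[_ [U Uu [UST _]]]].
  split=> //; exists U => //; apply: intertwines_unitary => //.
  by rewrite -mulmxA unitarymx_square // mulmx1.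
by exists U => //; rewrite -UST -mulmxA (unitarymxP Uu) mulmx1.
Qed.

Lemma equivmx_castmx m n (e : m = n) (A : 'M[C]_m) :
  equivmx (castmx (e, e) A) A.
Proof. by case: n / e; rewrite castmx_id; exact: equivmx_refl. Qed.

Lemma unitary_equiv_castmx m n (e : m = n) (S : 'M[C]_n) (A : 'M[C]_m) :
  unitary_equiv S (castmx (e, e) A) <-> equivmx S A.
Proof.
rewrite unitary_equivE; split=> SA; apply: (equivmx_trans SA).
  exact: equivmx_castmx.
exact/equivmx_sym/equivmx_castmx.
Qed.

Lemma equivmx_conj m n (W : 'M[C]_(m, n)) (T : 'M_n) :
  W \is unitarymx -> m = n -> equivmx (W *m T *m W^t*) T.
Proof.
move=> Wu emn; split=> //; exists W => //; apply: intertwines_unitary => //.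
by rewrite -mulmxA unitarymx_square // mulmx1.
Qed.

Lemma equivmx0 m n (S : 'M[C]_m) (T : 'M_n) : m = 0%N -> n = 0%N -> equivmx S T.
Proof.
move=> m0 n0; split; first by rewrite m0.
subst m n; exists 0; first by rewrite qualifE /= flatmx0 [_%:M]flatmx0.
by split; rewrite flatmx0 [RHS]flatmx0.
Qed.

(** Conjugating the two equations exchanges their roles, because the conjugate of [S^*] is [S^T]. *)
Lemma intertwines_tr m n (V : 'M[C]_(m, n)) S T :
  intertwines V S T -> intertwines (map_mx Num.conj V) S^T T^T.
Proof.
move=> [VST VST'].
have cc p q (A : 'M[C]_(p, q)) : map_mx Num.conj (map_mx Num.conj A) = A.
  by apply/matrixP => i j; rewrite !mxE conjCK.
split.
  by rewrite -[S^T]cc -map_mxM VST' map_mxM cc.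
by rewrite !trmxK -!map_mxM VST.
Qed.

Lemma summand_tr m n (S : 'M[C]_m) (T : 'M_n) : summand S T -> summand S^T T^T.
Proof.
case=> V Vu VST; exists (map_mx Num.conj V); last exact: intertwines_tr.
by rewrite conjC_unitary.
Qed.

Lemma equivmx_tr m n (S : 'M[C]_m) (T : 'M_n) : equivmx S T -> equivmx S^T T^T.
Proof. by case=> emn ST; split=> //; exact: summand_tr. Qed.

(** The row space of [V] is stable under [T] and under [T^*], so both off-diagonal blocks vanish in
    a basis that extends the rows of [V]. *)
Lemma summand_complement m n (A : 'M[C]_m) (T : 'M_n) :
  summand A T -> exists k (B : 'M[C]_k), equivmx T (A ⊕ B).
Proof.
case=> V Vu VAT; have [VA _] := VAT; have [AV _] := intertwines_adj VAT.
have [k [Q [emk Wu]]] := exists_orthogonal_complement Vu.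
exists k, (Q *m T *m Q^t*).
suff <- : col_mx V Q *m T *m (col_mx V Q)^t* = A ⊕ (Q *m T *m Q^t*).
  exact/equivmx_sym/equivmx_conj.
have := unitarymxP Wu.
rewrite tr_col_mx map_row_mx mul_col_row [1%:M]scalar_mx_block.
move=> /eq_block_mx[VV VQ QV QQ].
rewrite mul_col_mx mul_col_row -VA -!mulmxA VQ VV mulmx1 mulmx0 AV.
by rewrite [Q *m (_ *m _)]mulmxA QV mul0mx.
Qed.

Lemma intertwines_dsuml a b (A : 'M[C]_a) (B : 'M_b) :
  intertwines (row_mx 1%:M 0) A (A ⊕ B).
Proof.
rewrite /intertwines adjmx_block !adjmx0.
by rewrite !mul_mx_row !mul_row_block !mul1mx !mulmx1 !mulmx0 !mul0mx !addr0.
Qed.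

Lemma intertwines_dsumr a b (A : 'M[C]_a) (B : 'M_b) :
  intertwines (row_mx 0 1%:M) B (A ⊕ B).
Proof.
rewrite /intertwines adjmx_block !adjmx0.
by rewrite !mul_mx_row !mul_row_block !mul1mx !mulmx1 !mulmx0 !mul0mx !add0r.
Qed.

Lemma summand_dsuml a b (A : 'M[C]_a) (B : 'M_b) : summand A (A ⊕ B).
Proof.
exists (row_mx 1%:M 0); last exact: intertwines_dsuml.
apply/unitarymxP; rewrite tr_row_mx map_col_mx mul_row_col adjmx1 mulmx1.
by rewrite mul0mx addr0.
Qed.

Lemma equivmx_dsum a b a' b' (A : 'M[C]_a) (B : 'M_b) (A' : 'M_a') (B' : 'M_b') :
  equivmx A A' -> equivmx B B' -> equivmx (A ⊕ B) (A' ⊕ B').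
Proof.
move=> [ea [V Vu [VA VA']]] [eb [W Wu [WB WB']]].
split; first by rewrite ea eb.
exists (V ⊕ W); last first.
  rewrite /intertwines !adjmx_block !adjmx0 !mulmx_block.
  by rewrite !mulmx0 !mul0mx !addr0 !add0r VA VA' WB WB'.
apply/unitarymxP; rewrite adjmx_block !adjmx0 mulmx_block.
rewrite !mulmx0 !mul0mx !addr0 !add0r (unitarymxP Vu) (unitarymxP Wu).
by rewrite -scalar_mx_block.
Qed.

Lemma equivmx_dsumCA a b c (A : 'M[C]_a) (B : 'M_b) (D : 'M_c) :
  equivmx (A ⊕ (B ⊕ D)) (B ⊕ (A ⊕ D)).
Proof.
have e : (a + (b + c))%N = (b + (a + c))%N by rewrite addnCA.
split=> //.
pose U : 'M[C]_(a + (b + c), b + (a + c)) :=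
  block_mx 0 (row_mx 1%:M 0) (col_mx 1%:M 0) (block_mx 0 0 0 1%:M).
have Uu : U \is unitarymx.
  apply/unitarymxP; rewrite /U !adjmx_block !tr_row_mx !tr_col_mx.
  rewrite !map_row_mx !map_col_mx !adjmx0 !adjmx1 mulmx_block.
  rewrite !mul_row_col !mul_col_row !mulmx_block.
  rewrite ?mul_row_block ?mul_block_col.
  rewrite !mulmx0 !mul0mx !addr0 !add0r ?mulmx1 ?row_mx0 ?col_mx0 ?add_block_mx.
  rewrite !addr0 !add0r -scalar_mx_block ?mulmx0 ?mul0mx.
  by rewrite -scalar_mx_block.
exists U => //; apply: intertwines_unitary => //.
rewrite /U !mulmx_block !mulmx0 !mul0mx !addr0 !add0r.
rewrite !mul_mx_row !mul_row_block !mul_block_col !mul_col_mx.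
by rewrite !mulmx0 !mul0mx !addr0 ?add0r !mulmx1 !mul1mx.
Qed.

Lemma equivmx_dsumA a b c (A : 'M[C]_a) (B : 'M_b) (D : 'M_c) :
  equivmx (A ⊕ (B ⊕ D)) ((A ⊕ B) ⊕ D).
Proof.
have e : (a + (b + c))%N = ((a + b) + c)%N by rewrite addnA.
split=> //.
pose U : 'M[C]_(a + (b + c), (a + b) + c) :=
  block_mx (row_mx 1%:M 0) 0 (block_mx 0 1%:M 0 0) (col_mx 0 1%:M).
have Uu : U \is unitarymx.
  apply/unitarymxP; rewrite /U !adjmx_block !tr_row_mx !tr_col_mx.
  rewrite !map_row_mx !map_col_mx !adjmx0 !adjmx1 mulmx_block.
  rewrite !mul_row_col !mul_col_row !mulmx_block.
  rewrite ?mul_row_block ?mul_block_col.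
  rewrite !mulmx0 !mul0mx !addr0 !add0r ?mulmx1 ?row_mx0 ?col_mx0 ?add_block_mx.
  rewrite !addr0 !add0r -scalar_mx_block ?mulmx0 ?mul0mx.
  by rewrite -scalar_mx_block.
exists U => //; apply: intertwines_unitary => //.
rewrite /U !mulmx_block !mulmx0 !mul0mx !addr0 !add0r.
rewrite !mul_mx_row !mul_row_block !mul_block_col !mul_col_mx.
by rewrite !mulmx0 !mul0mx !addr0 ?add0r !mulmx1 !mul1mx.
Qed.

End Equivalence.

(** * Schur's lemma and cancellation *)

Section Irreducible.
Variable C : numClosedFieldType.

(** This is the form used later: it is free of casts, and a subspace only has to be shown reducing
    and nonzero. *)
Lemma irreducible_mxP n (T : 'M[C]_n) :
  irreducible_mx T <->
  (0 < n)%N /\ forall m (A : 'M[C]_m), (0 < m)%N -> summand A T -> m = n.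
Proof.
split=> -[n0 irrT]; split=> //.
  move=> m A m0 /summand_complement[k [B TAB]].
  have emk : (m + k)%N = n by case: TAB.
  have [k0|k0] := posnP k; first by rewrite -emk k0 addn0.
  case: irrT; exists m, k, emk, A, B; split=> //.
  exact/unitary_equiv_castmx.
case=> d1 [d2 [e [A [B [d1_gt0 d2_gt0 /unitary_equiv_castmx TAB]]]]].
have AT : summand A T.
  by apply: summand_trans (summand_dsuml A B) _; case/equivmx_sym: TAB.
have := irrT _ _ d1_gt0 AT; rewrite -e => /eqP.
by rewrite -[X in X == _]addn0 eqn_add2l eq_sym; case: d2 d2_gt0 {e B TAB}.
Qed.

Lemma irreducible_equiv m n (S : 'M[C]_m) (T : 'M[C]_n) :
  equivmx S T -> irreducible_mx T -> irreducible_mx S.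
Proof.
move=> [emn ST] /irreducible_mxP[n0 irrT]; apply/irreducible_mxP.
split=> [|k A k0 AS]; first by rewrite emn.
by rewrite emn; apply: irrT k0 (summand_trans AS ST).
Qed.

Lemma irreducible_tr n (T : 'M[C]_n) : irreducible_mx T -> irreducible_mx T^T.
Proof.
move=> /irreducible_mxP[n0 irrT]; apply/irreducible_mxP; split=> // m A m0.
by move/summand_tr; rewrite trmxK; exact: irrT.
Qed.

Lemma exists_irreducible_summand n (T : 'M[C]_n) : (0 < n)%N ->
  exists m (A : 'M[C]_m), irreducible_mx A /\ summand A T.
Proof.
elim/ltn_ind: n T => n IHn T n0.
have [irrT|NirrT] := EM (irreducible_mx T).
  by exists n, T; split=> //; case: (equivmx_refl T).
have [m [A [m0 AT mn]]] :
    exists m (A : 'M[C]_m), [/\ (0 < m)%N, summand A T & m <> n].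
  apply: contrapT => NA; apply/NirrT/irreducible_mxP; split=> // m A m0 AT.
  by apply: contrapT => mn; apply: NA; exists m, A.
have ltmn : (m < n)%N by rewrite ltn_neqAle (summand_leq AT) andbT; exact/eqP.
have [k [B [irrB BA]]] := IHn m ltmn A m0.
by exists k, B; split=> //; exact: summand_trans BA AT.
Qed.

Lemma stable_intertwines m n (V : 'M[C]_(m, n)) (T : 'M_n) :
  V \is unitarymx -> stablemx V T -> stablemx V (T^t*) ->
  intertwines V (V *m T *m V^t*) T.
Proof.
move=> Vu /submxP[D VT] /submxP[D' VT'].
have -> : V *m T *m V^t* = D by rewrite VT mulmxtVK.
split=> //; rewrite VT'; congr (_ *m _).
by rewrite -[RHS](mulmxtVK _ Vu) -VT' -mulmxA -adjmxM VT adjmxM mulmxA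
  (unitarymxP Vu) mul1mx.
Qed.

(** Schur: an eigenspace of [X] is stable under whatever commutes with [X], in particular under [T]
    and [T^*]; being reducing and nonzero, it is the whole space. *)
Lemma irreducible_intertwines_scalar n (T X : 'M[C]_n) :
  irreducible_mx T -> intertwines X T T -> exists c, X = c%:M.
Proof.
move=> /irreducible_mxP[n0 irrT] [XT XT'].
have [c cP] := eigenvalue_closed X n0; exists c.
pose E := eigenspace X c; pose V := schmidt (row_base E).
have VE : (V :=: E)%MS.
  apply: eqmx_trans (eq_row_base _).
  by apply: eqmx_schmidt_free; rewrite row_base_free.
have Vu : V \is unitarymx by rewrite schmidt_unitarymx ?rank_leq_col.
have stV (Y : 'M_n) : Y *m X = X *m Y -> stablemx V Y.
  move=> YX; rewrite (eqmxMr _ VE) VE.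
  exact: comm_mx_stable_eigenspace.
have rE : \rank E = n.
  apply: irrT; first by rewrite lt0n mxrank_eq0.
  by exists V => //; apply: stable_intertwines; rewrite ?stV.
have VX : V *m X = c *: V by apply/eigenspaceP; rewrite VE.
have := unitarymx_square Vu rE => VV.
by rewrite -[X]mul1mx -VV -mulmxA VX -scalemxAr VV scalemx1.
Qed.

(** By Schur, [W W^*] and [W^* W] are scalar. They are the same positive scalar, and dividing [W] by
    its square root gives a unitary. *)
Lemma intertwines_irreducible_equiv m n (W : 'M[C]_(m, n)) (S : 'M_m) (T : 'M_n) :
  irreducible_mx S -> irreducible_mx T -> intertwines W S T -> W != 0 ->
  equivmx S T.
Proof.
move=> irrS irrT WST W0; have WTS := intertwines_adj WST.
have [c Wc] := irreducible_intertwines_scalar irrS (intertwinesM WST WTS).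
have [d Wd] := irreducible_intertwines_scalar irrT (intertwinesM WTS WST).
have c0 : c != 0.
  apply: contra W0 => /eqP c0; apply/eqP/mulmx_adj_eq0.
  by rewrite Wc c0 raddf0.
(* Both sides of [c W = W W^* W = d W] are compared, with [W] nonzero. *)
have ecd : c = d.
  apply/eqP; rewrite -subr_eq0; apply: contraR W0 => cd0; apply/eqP.
  have : (c - d) *: W = 0.
    by rewrite scalerBl -!mul_scalar_mx -Wc -mulmxA Wd mul_mx_scalar
      mul_scalar_mx subrr.
  by move/eqP; rewrite scaler_eq0 (negPf cd0) => /eqP.
have c_gt0 : 0 < c.
  rewrite lt_def c0 /=.
  (* Irreducibility excludes size 0, so [c] is a diagonal entry of [W W^*], that is, a sum of
     squared moduli. *)
  case: m {irrT} S W irrS {WST W0 WTS Wd} Wc => [S W []//|m] S W _ Wc.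
  have := congr1 (fun M : 'M_m.+1 => M 0 0) Wc; rewrite !mxE eqxx mulr1n => <-.
  by rewrite sumr_ge0 // => j _; rewrite !mxE mul_conjC_ge0.
pose r := (sqrtC c)^-1.
have r_real : r^* = r by apply/CrealP; rewrite realV ger0_real // sqrtC_ge0 ltW.
have rr : r * r * c = 1.
  by rewrite -invfM -expr2 sqrtCK mulVf.
have VV : (r *: W) *m (r *: W)^t* = 1%:M.
  by rewrite adjmxZ -scalemxAl -scalemxAr scalerA r_real Wc scale_scalar_mx rr.
have VV' : (r *: W)^t* *m (r *: W) = 1%:M.
  rewrite adjmxZ -scalemxAl -scalemxAr scalerA r_real Wd -ecd.
  by rewrite scale_scalar_mx rr.
have Vu : r *: W \is unitarymx by apply/unitarymxP.
have Vu' : (r *: W)^t* \is unitarymx by apply/unitarymxP; rewrite trmxCK.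
have emn : m = n.
  by apply/eqP; rewrite eqn_leq !(unitarymx_leq Vu, unitarymx_leq Vu').
split=> //; exists (r *: W) => //; apply: intertwines_unitary => //.
by case: WST => WST _; rewrite -scalemxAr WST scalemxAl.
Qed.

(** The two components of [V] intertwine [D] with [A] and with [B]. The first vanishes by Schur,
    which leaves the second with orthonormal rows. *)
Lemma irreducible_summand_dsum a b d (A : 'M[C]_a) (B : 'M_b) (D : 'M_d) :
  irreducible_mx A -> irreducible_mx D -> ~ equivmx D A ->
  summand D (A ⊕ B) -> summand D B.
Proof.
move=> irrA irrD NDA [V]; rewrite -[V]hsubmxK.
move: (lsubmx V) (rsubmx V) => V1 V2 Vu DV.
have iA : intertwines V1 D A.
  have := intertwinesM DV (intertwines_adj (intertwines_dsuml A B)).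
  by rewrite tr_row_mx map_col_mx mul_row_col adjmx1 adjmx0 mulmx1 mulmx0 addr0.
have iB : intertwines V2 D B.
  have := intertwinesM DV (intertwines_adj (intertwines_dsumr A B)).
  by rewrite tr_row_mx map_col_mx mul_row_col adjmx1 adjmx0 mulmx1 mulmx0 add0r.
have V10 : V1 = 0.
  apply/eqP; apply: contrapT => /negP V1_neq0.
  exact/NDA/(intertwines_irreducible_equiv irrD irrA iA).
exists V2 => //; apply/unitarymxP; move/unitarymxP: Vu; rewrite V10.
by rewrite tr_row_mx map_col_mx mul_row_col mul0mx add0r.
Qed.

(* Closing the loop of the unitary [U] on its first component through the
   feedback [x = l^-1 * (x u11 + b u21)], [|l| = 1], yields a unitary [W]. *)
Lemma irreducible_cancel a b d (A : 'M[C]_a) (B : 'M_b) (D : 'M_d) :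
  irreducible_mx A -> equivmx (A ⊕ B) (A ⊕ D) -> equivmx B D.
Proof.
move=> irrA [/eqP eabd]; move: eabd; rewrite eqn_add2l => /eqP ebd.
case: d / ebd D => D [U Uu]; rewrite -[U]submxK in Uu *.
set u11 := ulsubmx U; set u12 := ursubmx U.
set u21 := dlsubmx U; set u22 := drsubmx U.
case; rewrite !adjmx_block !adjmx0 !mulmx_block !mulmx0 !mul0mx !addr0 !add0r.
move=> /eq_block_mx[A11 A12 B21 B22] /eq_block_mx[A11' _ _ _].
have [c cE] := irreducible_intertwines_scalar irrA (conj A11 A11').
(* One of 1 and -1 differs from [c]; this makes the feedback equation solvable. *)
have [l lc ll] : exists2 l : C, l - c != 0 & l * l^* = 1.
  have [c1|c1] := eqVneq c 1; last first.
    by exists 1; rewrite ?subr_eq0 1?eq_sym ?conjC1 ?mulr1.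
  exists (-1); last by rewrite -normCK normrN1 expr1n.
  by rewrite c1 -opprD oppr_eq0 -[1 + 1]/(2%:R) pnatr_eq0.
have [X XE] : exists X : 'M_(b, a), u21 = (l - c) *: X.
  by exists ((l - c)^-1 *: u21); rewrite scalerKV.
pose W := u22 + X *m u12.
(* [U] sends the rows of [(X, 1)] to those of [(l X, W)] and preserves Gram matrices; as [|l| = 1],
   the terms [X X^*] cancel and leave [W W^* = 1]. *)
have XU : row_mx X 1%:M *m block_mx u11 u12 u21 u22 = row_mx (l *: X) W.
  rewrite mul_row_block !mul1mx [X *m u12 + _]addrC; congr row_mx.
  rewrite cE mul_mx_scalar XE -scalerDl.
  by rewrite addrCA subrr addr0.
have Wu : W \is unitarymx.
  apply/unitarymxP.
  have : row_mx X 1%:M *m (row_mx X 1%:M)^t* =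
         row_mx (l *: X) W *m (row_mx (l *: X) W)^t*.
    by rewrite -XU adjmxM mulmxA mulmxtVK.
  rewrite !tr_row_mx !map_col_mx !mul_row_col adjmx1 mulmx1 adjmxZ.
  by rewrite -scalemxAl -scalemxAr scalerA ll scale1r => /addrI.
split=> //; exists W => //; apply: intertwines_unitary => //.
rewrite /W mulmxDr mulmxDl B22 -mulmxA -A12 !mulmxA; congr (_ + _ *m _).
by apply: (scalerI lc); rewrite scalemxAr scalemxAl -XE.
Qed.

End Irreducible.

(** * Antilinear symmetries *)

(* [G] encodes the antilinear map [v |-> conj v *m G] on row vectors; it squares
   to [eps] and turns [T] into [T^t*]. *)
Definition transposable (C : numClosedFieldType) (eps : C) n (T : 'M[C]_n) :=
  exists G : 'M[C]_n, [/\ G \is unitarymx, G^T = eps *: G & G *m T = T^T *m G].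

Section Transposer.
Variable C : numClosedFieldType.

Lemma conjCmxK m n (A : 'M[C]_(m, n)) : conjm (conjm A) = A.
Proof. by apply/matrixP => i j; rewrite !mxE conjCK. Qed.

Lemma conjCmxE m n (A : 'M[C]_(m, n)) : conjm A = (A^t*)^T.
Proof. by rewrite map_trmx trmxK. Qed.

Lemma unitarymx_neq0 m n (V : 'M[C]_(m, n)) :
  (0 < m)%N -> V \is unitarymx -> V != 0.
Proof. by move=> m0 Vu; rewrite -mxrank_eq0 (mxrank_unitary Vu) -lt0n. Qed.

Lemma UET_transposer n (T : 'M[C]_n) :
  UET T <-> exists2 G : 'M[C]_n, G \is unitarymx & G *m T = T^T *m G.
Proof.
split=> [[U Uu TE]|[G Gu GT]].
  exists (U^t*); first by rewrite trmxC_unitary.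
  by rewrite {1}TE !mulmxA unitarymx_square // mul1mx.
exists (G^t*); first by rewrite trmxC_unitary.
by rewrite trmxCK -mulmxA -GT mulmxA unitarymx_square // mul1mx.
Qed.

Lemma transposable_UET eps n (T : 'M[C]_n) : transposable eps T -> UET T.
Proof. by move=> [G [Gu _ GT]]; apply/UET_transposer; exists G. Qed.

(** A unitary change of basis acts on [G] by the congruence [conj U G U^*], where [conj U] is the
    transpose of [U^*]; congruence preserves the sign [eps]. *)
Lemma transposable_equiv eps m n (S : 'M[C]_m) (T : 'M[C]_n) :
  equivmx S T -> transposable eps T -> transposable eps S.
Proof.
move=> [emn]; case: n / emn T => T [U Uu [ST _]] [G [Gu Gs GT]].
have SE : S = U *m T *m U^t* by rewrite -ST -mulmxA (unitarymxP Uu) mulmx1.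
have UU := unitarymx_square Uu erefl.
exists (conjm U *m G *m U^t*); split.
- by rewrite !mul_unitarymx ?conjC_unitary ?trmxC_unitary ?trmx_unitary.
- rewrite !trmx_mul Gs -conjCmxE map_trmx.
  by rewrite -scalemxAl -scalemxAr mulmxA.
- have UcU : U^T *m conjm U = 1%:M.
    by rewrite conjCmxE -trmx_mul UU trmx1.
  rewrite SE !trmx_mul -conjCmxE !mulmxA.
  rewrite -[_ *m U^t* *m U]mulmxA UU mulmx1 -[_ *m G *m T]mulmxA GT.
  by rewrite -[_ *m U^T *m _]mulmxA UcU mulmx1 !mulmxA.
Qed.

Lemma UET_equiv m n (S : 'M[C]_m) (T : 'M[C]_n) :
  equivmx S T -> UET T -> UET S.
Proof.
move=> ST /unitary_equivE TT; apply/unitary_equivE.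
apply: (equivmx_trans ST); apply: (equivmx_trans TT).
exact/equivmx_tr/equivmx_sym.
Qed.

(** Along with [G], its transpose also carries [T] to [T^T], so the unitary [G^* G^T] commutes with
    [T] and is a scalar [c]. Transposing [G^T = c G] once more gives [c^2 = 1]. *)
Lemma irreducible_transposable n (T : 'M[C]_n) : irreducible_mx T -> UET T ->
  transposable 1 T \/ transposable (-1) T.
Proof.
move=> irrT /UET_transposer[G Gu GT]; have [n0 _] := irrT.
have GTT : G^T *m T = T^T *m G^T by rewrite -[T in LHS]trmxK -!trmx_mul GT.
have GG := unitarymx_square Gu erefl.
have GtG : intertwines (G^t* *m G^T) T T.
  apply: intertwines_unitary => //.
    by rewrite mul_unitarymx ?trmxC_unitary ?trmx_unitary.
  rewrite -[RHS]mulmxA GTT !mulmxA; congr (_ *m _).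
  have := congr1 (fun X => G^t* *m X *m G^t*) GT.
  by rewrite /= !mulmxA GG mul1mx -!mulmxA (unitarymxP Gu) mulmx1.
have [c cE] := irreducible_intertwines_scalar irrT GtG.
have Gc : G^T = c *: G.
  by rewrite -mul_mx_scalar -cE mulmxA (unitarymxP Gu) mul1mx.
have cc : c ^+ 2 = 1.
  have G0 := unitarymx_neq0 n0 Gu.
  have : (1 - c ^+ 2) *: G = 0.
    apply/eqP; rewrite scalerBl scale1r subr_eq0; apply/eqP.
    by rewrite -[LHS]trmxK Gc linearZ /= Gc scalerA expr2.
  by move/eqP; rewrite scaler_eq0 (negPf G0) orbF subr_eq0 eq_sym => /eqP.
have /orP[/eqP c1|/eqP c1] : (c == 1) || (c == -1) by rewrite -sqrf_eq1 cc.
  by left; exists G; rewrite -c1.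
by right; exists G; rewrite -c1.
Qed.

(** By Schur [K] is a multiple of [G], hence both symmetric and skew, hence zero. *)
Lemma irreducible_not_both n (T : 'M[C]_n) : irreducible_mx T ->
  transposable 1 T -> transposable (-1) T -> False.
Proof.
move=> irrT [G [Gu Gs GT]] [K [Ku Ks KT]]; have [n0 _] := irrT.
have GG := unitarymx_square Gu erefl.
have GK : intertwines (G^t* *m K) T T.
  apply: intertwines_unitary => //; first by rewrite mul_unitarymx ?trmxC_unitary.
  rewrite -[RHS]mulmxA KT !mulmxA; congr (_ *m _).
  have := congr1 (fun X => G^t* *m X *m G^t*) GT.
  by rewrite /= !mulmxA GG mul1mx -!mulmxA (unitarymxP Gu) mulmx1.
have [c cE] := irreducible_intertwines_scalar irrT GK.
have Kc : K = c *: G.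
  by rewrite -mul_mx_scalar -cE mulmxA (unitarymxP Gu) mul1mx.
have K0 : K = 0.
  have : K = - K.
    by rewrite -{1}[K]trmxK Ks linearZ /= Kc linearZ /= Gs scale1r scaleN1r.
  move/eqP; rewrite -addr_eq0 -mulr2n -scaler_nat scaler_eq0 pnatr_eq0 /=.
  by move/eqP.
by have := unitarymx_neq0 n0 Ku; rewrite K0 eqxx.
Qed.

(* Takagi: a symmetric unitary [G] is [V^T *m V] with [V] unitary, the square
   root of [G] given by the functional calculus being symmetric. *)
Lemma symmetric_unitary_factor n (G : 'M[C]_n) :
  G \is unitarymx -> G^T = G ->
  exists2 V : 'M[C]_n, V \is unitarymx & G = V^T *m V.
Proof.
move=> Gu Gs; have GG := unitarymx_square Gu erefl.
have /orthomx_spectralP : G \is normalmx.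
  by apply/normalmxP; rewrite GG (unitarymxP Gu).
set P := spectralmx G; set s := spectral_diag G => GE.
have Pu : P \is unitarymx by exact: spectral_unitarymx.
have PP := unitarymx_square Pu erefl.
rewrite invmx_unitary // in GE.
have sE : diag_mx s = P *m G *m P^t*.
  by rewrite GE !mulmxA (unitarymxP Pu) mul1mx mulmxtVK.
pose r : 'rV[C]_n := \row_j sqrtC (s 0 j).
have rr : diag_mx r *m diag_mx r = diag_mx s.
  rewrite mulmx_diag; congr diag_mx; apply/rowP => j; rewrite !mxE.
  by rewrite -expr2 sqrtCK.
have ru : diag_mx r \is unitarymx.
  have su : diag_mx s \is unitarymx.
    by rewrite sE !mul_unitarymx ?trmxC_unitary.
  have s1 j : `|s 0 j| = 1.
    have := congr1 (fun M : 'M_n => M j j) (unitarymxP su).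
    rewrite tr_diag_mx map_diag_mx mulmx_diag !mxE eqxx /= !mulr1n -normCK.
    move/eqP; rewrite sqrf_eq1 => /orP[/eqP//|/eqP sN1].
    by have := normr_ge0 (s 0 j); rewrite sN1 oppr_ge0 ler10.
  apply/unitarymxP; rewrite tr_diag_mx map_diag_mx mulmx_diag.
  apply/matrixP => i j; rewrite !mxE; case: eqP => // _; rewrite !mulr1n -normCK.
  by rewrite -normrX sqrtCK s1.
(* Read in the eigenbasis, the symmetry of [G] says that [P P^T] commutes with [diag_mx s]. *)
pose Q := P *m P^T.
have sQ : diag_mx s *m Q = Q *m diag_mx s.
  have PcP : P^t*^T *m P^T = 1%:M by rewrite -trmx_mul (unitarymxP Pu) trmx1.
  have -> : diag_mx s *m Q = P *m G *m P^T.
    by rewrite /Q sE !mulmxA mulmxKtV.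
  rewrite -Gs GE !trmx_mul tr_diag_mx /Q !mulmxA.
  by rewrite -[_ *m P^t*^T *m _]mulmxA PcP mulmx1.
(* A nonzero entry [Q i j] forces [s i = s j], hence equal chosen square roots. *)
have rQ : diag_mx r *m Q = Q *m diag_mx r.
  move: sQ; move: (Q) => Z sZ.
  apply/matrixP => i j; have := congr1 (fun M : 'M_n => M i j) sZ.
  rewrite /= !mul_diag_mx !mul_mx_diag !mxE => sij.
  have [->|Zij] := eqVneq (Z i j) 0; first by rewrite mulr0 mul0r.
  suff -> : s 0 i = s 0 j by rewrite mulrC.
  by apply: (mulfI Zij); rewrite mulrC.
pose V := P^t* *m diag_mx r *m P.
have Vs : V^T = V.
  rewrite /V !trmx_mul tr_diag_mx.
  have -> : P^T *m (diag_mx r *m P^t*^T) = P^t* *m (Q *m diag_mx r) *m P^t*^T.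
    by rewrite /Q !mulmxA PP mul1mx.
  rewrite -rQ /Q !mulmxA -[X in X = _]mulmxA -trmx_mul.
  by rewrite (unitarymx_square _ erefl) // trmx1 mulmx1.
exists V; first by rewrite /V !mul_unitarymx ?trmxC_unitary.
by rewrite Vs /V !mulmxA mulmxtVK // -[P^t* *m diag_mx r *m diag_mx r]mulmxA rr GE.
Qed.

(** Conjugating [T] by the Takagi factor [V] of [G] turns [G] into the identity, and [G T = T^T G]
    into symmetry. *)
Lemma UECSM_transposable n (T : 'M[C]_n) : UECSM T <-> transposable 1 T.
Proof.
split=> [[S Ss /unitary_equivE TS]|[G [Gu Gs GT]]].
  apply: (transposable_equiv TS); exists 1%:M.
  rewrite trmx1 scale1r mul1mx mulmx1; split=> //.
  by apply/unitarymxP; rewrite adjmx1 mulmx1.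
have [V Vu GE] := symmetric_unitary_factor Gu (etrans Gs (scale1r G)).
exists (V *m T *m V^t*); last by apply/unitary_equivE/equivmx_sym/equivmx_conj.
have VVT : conjm V *m V^T = 1%:M.
  by rewrite conjCmxE -trmx_mul (unitarymxP Vu) trmx1.
rewrite /complex_symmetric !trmx_mul -conjCmxE.
rewrite GE in GT.
have := congr1 (fun X => conjm V *m X *m V^t*) GT.
by rewrite /= !mulmxA VVT mul1mx mulmxtVK.
Qed.

End Transposer.

(** * Skew-Hamiltonian normal form *)

Section Symplectic.
Variable C : numClosedFieldType.

Lemma hermitian_eigenvector n (H : 'M[C]_n.+1) : H^t* = H ->
  exists (y : 'rV[C]_n.+1) a, y \is unitarymx /\ y *m H = a *: y.
Proof.
move=> Hh; have /orthomx_spectralP : H \is normalmx by apply/normalmxP; rewrite Hh.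
set P := spectralmx H; set s := spectral_diag H => HE.
have Pu : P \is unitarymx by exact: spectral_unitarymx.
have PH : P *m H = diag_mx s *m P.
  by rewrite {1}HE invmx_unitary // !mulmxA (unitarymxP Pu) mul1mx.
exists (row 0 P), (s 0 0); split.
  apply/row_unitarymxP => i j; rewrite !ord1 eqxx !row_id.
  by have /row_unitarymxP -> := Pu.
by rewrite -row_mul PH; apply/rowP => j; rewrite mul_diag_mx !mxE.
Qed.

(** The rows of [conjm V *m G] are the partners of the rows of [V] under the antilinear map of [G].
    Their Gram matrix is the conjugate of that of [V], so only the mixed block remains to be
    controlled. *)
Lemma symplectic_pair_unitaryP k n (G : 'M[C]_n) (V : 'M[C]_(k, n)) :
  G \is unitarymx ->
  col_mx V (conjm V *m G) \is unitarymx <->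
  V \is unitarymx /\ V *m G^t* *m V^T = 0.
Proof.
move=> Gu; have adjVG : (conjm V *m G)^t* = G^t* *m V^T.
  by rewrite adjmxM map_trmx conjCmxK.
have GVT : conjm V *m G *m V^t* = (V *m G^t* *m V^T)^t*.
  by rewrite !adjmxM trmxK trmxCK mulmxA.
have conjVV : conjm V *m G *m (G^t* *m V^T) = conjm (V *m V^t*).
  by rewrite mulmxA mulmxtVK // map_mxM conjCmxK.
split=> [/unitarymxP|[/unitarymxP Vu V0]]; last apply/unitarymxP;
  rewrite tr_col_mx map_row_mx mul_col_row adjVG GVT conjVV [V *m (_ *m _)]mulmxA.
  by rewrite [1%:M]scalar_mx_block => /eq_block_mx[/unitarymxP Vu -> _ _].
by rewrite Vu V0 adjmx0 map_mx1 -scalar_mx_block.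
Qed.

(** Eigenvectors of [H] are collected one at a time, each with its partner; the next one is taken in
    the orthogonal complement of the pairs found so far. The bound is [n.+1] because room for one
    more vector already yields a whole pair, which later forces [n] to be even. *)
Lemma symplectic_basis_half n (G H : 'M[C]_n) k :
  G \is unitarymx -> G^T = - G -> H^t* = H -> G *m H = H^T *m G ->
  (k + k <= n.+1)%N ->
  exists (V : 'M[C]_(k, n)) (s : 'rV_k),
    col_mx V (conjm V *m G) \is unitarymx /\ V *m H = diag_mx s *m V.
Proof.
move=> Gu Gs Hh GH; elim: k => [|k IHk] lek.
  exists 0, 0; split; last by rewrite flatmx0 [RHS]flatmx0.
  apply/unitarymxP; apply/matrixP => -[]; by case.
have ltkn : (k + k < n)%N by move: lek; rewrite addSn addnS !ltnS.
have [V [s [Wu VH]]] := IHk (leqW (ltnW ltkn)).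
set W := col_mx _ _ in Wu.
have [l [Q [ekl WQu]]] := exists_orthogonal_complement Wu.
have [Qu QW] : Q \is unitarymx /\ Q *m W^t* = 0.
  move/unitarymxP: WQu; rewrite tr_col_mx map_row_mx mul_col_row.
  by rewrite [1%:M]scalar_mx_block => /eq_block_mx[_ _ QW /unitarymxP Qu].
(* The antilinear map commutes with [H], so partners of eigenvectors are eigenvectors for the
   conjugate eigenvalues. *)
have KVH : conjm V *m G *m H = diag_mx (conjm s) *m (conjm V *m G).
  rewrite -mulmxA GH mulmxA; have := congr1 (map_mx Num.conj) VH.
  by rewrite !map_mxM map_diag_mx -{1}Hh conjCmxK => ->; rewrite mulmxA.
have [S WH] : exists S, W *m H = S *m W.
  exists (block_mx (diag_mx s) 0 0 (diag_mx (conjm s))).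
  by rewrite mul_col_mx mul_block_col !mul0mx addr0 add0r VH KVH.
(* [H] is Hermitian and preserves the span of [W], so it preserves the complement and an eigenvector
   can be sought there. *)
have QHW : Q *m H *m W^t* = 0.
  by rewrite -mulmxA -{1}Hh -adjmxM WH adjmxM mulmxA QW mul0mx.
have QH : Q *m H = (Q *m H *m Q^t*) *m Q.
  have := unitarymx_square WQu ekl.
  rewrite tr_col_mx map_row_mx mul_row_col => WQ.
  by rewrite -[LHS]mulmx1 -WQ mulmxDr !mulmxA QHW mul0mx add0r.
have l0 : (0 < l)%N.
  by move: ltkn; rewrite -ekl -[X in (X < _)%N]addn0 ltn_add2l.
case: l l0 Q ekl WQu Qu QW QHW QH => // l _ Q ekl WQu Qu QW QHW QH.
have Hh' : (Q *m H *m Q^t*)^t* = Q *m H *m Q^t*.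
  by rewrite !adjmxM trmxCK Hh mulmxA.
have [y [a [yu yH]]] := hermitian_eigenvector Hh'.
pose x := y *m Q.
have xu : x \is unitarymx by rewrite mul_unitarymx.
have xH : x *m H = a *: x.
  by rewrite -mulmxA QH mulmxA yH -scalemxAl.
have xW : x *m W^t* = 0 by rewrite -mulmxA QW mulmx0.
clearbody x.
have [xV xGV] : x *m V^t* = 0 /\ x *m G^t* *m V^T = 0.
  move: xW; rewrite tr_col_mx map_row_mx mul_mx_row adjmxM map_trmx conjCmxK.
  by rewrite -[0]row_mx0 mulmxA => /eq_row_mx[].
have [/unitarymxP Vu VGV] : V \is unitarymx /\ V *m G^t* *m V^T = 0.
  exact/(symplectic_pair_unitaryP V Gu).
have Gs' : G^t*^T = - G^t*.
  by rewrite -conjCmxE -[G in LHS]trmxK {1}Gs linearN /= map_mxN.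
(* Skewness of [G] makes every vector orthogonal to its own partner: a skew 1 x 1 matrix is zero. *)
have xGx : x *m G^t* *m x^T = 0.
  have : (x *m G^t* *m x^T)^T = - (x *m G^t* *m x^T).
    by rewrite !trmx_mul trmxK Gs' mulNmx mulmxN mulmxA.
  move/matrixP => /(_ 0 0); rewrite !mxE => /eqP.
  rewrite -addr_eq0 -mulr2n -mulr_natr mulf_eq0 pnatr_eq0 orbF => /eqP xGx.
  by apply/matrixP => i j; rewrite !ord1 !mxE.
have VGx : V *m G^t* *m x^T = 0.
  suff -> : V *m G^t* *m x^T = - (x *m G^t* *m V^T)^T.
    by rewrite xGV trmx0 oppr0.
  by rewrite !trmx_mul trmxK Gs' mulNmx mulmxN opprK mulmxA.
have Vx : V *m x^t* = 0 by rewrite -[LHS]trmxCK adjmxM trmxCK xV adjmx0.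
change (exists (V' : 'M[C]_(1 + k, n)) (s' : 'rV_(1 + k)),
  col_mx V' (conjm V' *m G) \is unitarymx /\ V' *m H = diag_mx s' *m V').
exists (col_mx x V), (row_mx a%:M s); split.
  apply/symplectic_pair_unitaryP => //; split.
    apply/unitarymxP; rewrite tr_col_mx map_row_mx mul_col_row.
    by rewrite (unitarymxP xu) Vu xV Vx -scalar_mx_block.
  rewrite tr_col_mx mul_col_mx mul_col_row xGx xGV VGx VGV.
  by rewrite /block_mx !row_mx0 col_mx0.
rewrite mul_col_mx diag_mx_row mul_block_col !mul0mx addr0 add0r VH.
congr col_mx; rewrite xH; apply/matrixP => i j; rewrite mul_diag_mx !mxE.
by rewrite !ord1 eqxx mulr1n.
Qed.

(** In a basis of eigenvectors of [H = T + T^*] followed by their partners, [T] takes the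
    skew-Hamiltonian shape. The last two clauses record that [H] is diagonal there; the size bound
    rests on them. *)
Lemma transposableN1_normal_form n (T : 'M[C]_n) : transposable (-1) T ->
  exists d (A B D : 'M[C]_d),
    [/\ B^T = - B, D^T = - D, equivmx T (block_mx A B D A^T), B + D^t* = 0
      & forall i j, i != j -> A i j + (A j i)^* = 0].
Proof.
case=> G [Gu]; rewrite scaleN1r => Gs GT.
pose H := T + T^t*.
have GG := unitarymx_square Gu erefl.
have conjG : conjm G = - G^t* by rewrite -[G in LHS]trmxK {1}Gs linearN /= map_mxN.
have Gs' : G^t*^T = - G^t* by rewrite -conjCmxE.
have conjT : (T^t*)^T = conjm T by rewrite -conjCmxE.
have TG : T *m G^t* = G^t* *m T^T.
  have := congr1 (fun X => G^t* *m X *m G^t*) GT.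
  by rewrite /= !mulmxA GG mul1mx -!mulmxA (unitarymxP Gu) mulmx1.
have Hh : H^t* = H by rewrite adjmxD trmxCK addrC.
have GT' : G *m T^t* = (T^t*)^T *m G.
  have := congr1 (fun X : 'M_n => X^t*) TG; rewrite !adjmxM trmxCK => ->.
  by rewrite conjT trmxK.
have GH : G *m H = H^T *m G by rewrite mulmxDr GT GT' linearD mulmxDl.
(* Half of [n] is rounded up: twice [uphalf n] orthonormal rows fit in dimension [n] only when [n]
   is even. *)
have le_d : (uphalf n + uphalf n <= n.+1)%N.
  by rewrite -[X in (_ <= X)%N]odd_double_half -addnn uphalfE leq_addl.
have [V [s [Wu VH]]] := symplectic_basis_half Gu Gs Hh GH le_d.
have edn : (uphalf n + uphalf n)%N = n.
  apply/eqP; rewrite eqn_leq (unitarymx_leq Wu) addnn -{1}[n]odd_double_half.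
  by rewrite uphalf_half doubleD leq_add2r; case: (odd n).
have [Vu VGV] := (symplectic_pair_unitaryP V Gu).1 Wu.
move: (uphalf n) edn V s Wu VH Vu VGV {le_d} => d edn V s Wu VH Vu VGV.
have adjVG : (conjm V *m G)^t* = G^t* *m V^T.
  by rewrite adjmxM map_trmx conjCmxK.
exists d, (V *m T *m V^t*), (V *m T *m G^t* *m V^T), (conjm V *m G *m T *m V^t*).
have conjV : V^t*^T = conjm V by rewrite -conjCmxE.
have conjVT : (conjm V)^T = V^t* by rewrite map_trmx.
split.
- rewrite !trmx_mul trmxK Gs' mulNmx mulmxN !mulmxA.
  by rewrite -[V *m T *m _]mulmxA TG !mulmxA.
- rewrite !trmx_mul conjV conjVT Gs !(mulNmx, mulmxN) !mulmxA; congr (- _).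
  by rewrite -[conjm V *m T^T *m G]mulmxA -GT !mulmxA.
- apply/equivmx_sym.
  suff <- : col_mx V (conjm V *m G) *m T *m (col_mx V (conjm V *m G))^t* =
      block_mx (V *m T *m V^t*) (V *m T *m G^t* *m V^T)
        (conjm V *m G *m T *m V^t*) (V *m T *m V^t*)^T by exact: equivmx_conj.
  rewrite tr_col_mx map_row_mx mul_col_mx mul_col_row adjVG !mulmxA.
  congr block_mx; rewrite !trmx_mul conjV -[conjm V *m G *m T]mulmxA GT !mulmxA.
  by rewrite mulmxtVK.
- rewrite !adjmxM trmxCK map_trmx conjCmxK -!mulmxA -mulmxDr !mulmxA.
  have -> : T *m G^t* *m V^T + T^t* *m G^t* *m V^T = H *m G^t* *m V^T.
    by rewrite !mulmxDl.
  by rewrite !mulmxA VH -!mulmxA [V *m _]mulmxA VGV mulmx0.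
- move=> i j Nij.
  have VHV : V *m H *m V^t* = diag_mx s by rewrite VH mulmxtVK.
  transitivity ((V *m H *m V^t*) i j); last by rewrite VHV mxE (negPf Nij).
  have -> : (V *m T *m V^t*) j i = ((V *m T^t* *m V^t*) i j)^*.
    have -> : V *m T^t* *m V^t* = (V *m T *m V^t*)^t*.
      by rewrite !adjmxM trmxCK mulmxA.
    by rewrite [X in X^*]mxE [X in X^*^*]mxE conjCK.
  by rewrite conjCK mulmxDr mulmxDl [RHS]mxE.
Qed.

Lemma skew_hamiltonian_transposable n (T : 'M[C]_n) :
  skew_hamiltonian T -> transposable (-1) T.
Proof.
case=> d [e [A [B [D [Bs Ds ->]]]]].
apply: transposable_equiv (equivmx_castmx e _) _.
(* For the standard symplectic matrix [J], the equation [J T = T^T J] expresses the skew-Hamiltonian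
   shape of [T]. *)
exists (block_mx 0 1%:M (- 1%:M) 0); split.
- apply/unitarymxP; rewrite adjmx_block !adjmx0 linearN /= map_mxN adjmx1.
  rewrite mulmx_block !mulmx0 !mul0mx !mulNmx !mulmxN !mulmx1 opprK.
  rewrite !addr0 !add0r ?oppr0.
  by rewrite -scalar_mx_block.
- rewrite tr_block_mx !trmx0 linearN /= trmx1 scale_block_mx !scaler0.
  by rewrite scalerN !scaleN1r opprK.
rewrite tr_block_mx !mulmx_block trmxK !mul0mx !mulmx0 !mulNmx !mulmxN.
by rewrite !mul1mx !mulmx1 !addr0 !add0r Bs Ds opprK.
Qed.

Lemma UESHM_transposable n (T : 'M[C]_n) : UESHM T <-> transposable (-1) T.
Proof.
split=> [[S SH /unitary_equivE TS]|/transposableN1_normal_form].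
  exact: transposable_equiv TS (skew_hamiltonian_transposable SH).
move=> [d [A [B [D [Bs Ds TE _ _]]]]].
have e : (d + d)%N = n by case: TE.
exists (castmx (e, e) (block_mx A B D A^T)).
  by exists d, e, A, B, D.
exact/unitary_equiv_castmx.
Qed.

End Symplectic.

(** * Quaternionic tiles and the size bounds *)

Section Tiles.
Variable C : numClosedFieldType.

Lemma ord2P (x : 'I_2) : x = 0 \/ x = lift 0 0.
Proof. by case: x => [[|[|//]]] ?; [left|right]; apply: val_inj. Qed.

(** Whichever of [m] and [m'] is not scalar serves as [z]; if both are scalar, any nonscalar matrix
    does. *)
Lemma commuting_pair_commutant2 (m m' : 'M[C]_2) : m *m m' = m' *m m ->
  exists z : 'M[C]_2,
    [/\ z *m m = m *m z, z *m m' = m' *m z & forall c, z != c%:M].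
Proof.
move=> mm'.
have [[c mc]|Nm] := EM (exists c, m = c%:M); last first.
  by exists m; split=> // c; apply/eqP => mc; apply: Nm; exists c.
have [[c' mc']|Nm'] := EM (exists c, m' = c%:M); last first.
  by exists m'; split=> // c1; apply/eqP => mc'; apply: Nm'; exists c1.
exists (delta_mx 0 0); rewrite mc mc'; split; rewrite ?scalar_mxC //.
move=> c1; apply/eqP => /matrixP dc.
have := dc 0 0; have := dc (lift 0 0) (lift 0 0); rewrite !mxE /= !mulr1n => <-.
by move/eqP; rewrite oner_eq0.
Qed.

(* The 2 x 2 tiles [t x y] behave like scalar multiples of a Hermitian
   quaternionic matrix: the diagonal is scalar, and an off-diagonal tile is
   zero or invertible, with inverse proportional to its mirror image. *)
Definition quaternionic_tiles d (t : 'I_d -> 'I_d -> 'M[C]_2)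
    (c : 'I_d -> 'I_d -> C) : Prop :=
  [/\ forall x, exists a, t x x = a%:M,
      forall x y, t x y *m t y x = (c x y)%:M,
      forall x y, c x y = c y x
    & forall x y, x != y -> c x y = 0 -> t x y = 0].

(** [q] is a block diagonal matrix commuting with the matrix of tiles. It may consist of scalar
    blocks, provided they are not all the same scalar. *)
Definition nonscalar_commutant d (t : 'I_d -> 'I_d -> 'M[C]_2) : Prop :=
  exists q : 'I_d -> 'M[C]_2,
    (forall x y, q x *m t x y = t x y *m q y) /\
    (forall c, exists x, q x != c%:M).

(** All tiles joining [i] to another index vanish, so the projection onto the coordinates of [i]
    commutes with everything. *)
Lemma isolated_commutant d (t : 'I_d -> 'I_d -> 'M[C]_2) c i j :
  quaternionic_tiles t c -> j != i -> (forall x, x != i -> c i x = 0) ->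
  nonscalar_commutant t.
Proof.
move=> [tD tt csym t0] ji ci.
exists (fun x => if x == i then 1%:M else 0); split=> [x y|a].
  have [->|xi] := eqVneq x i; have [->|yi] := eqVneq y i;
    rewrite ?mul1mx ?mulmx1 ?mul0mx ?mulmx0 //.
    by rewrite t0 ?ci // eq_sym.
  by rewrite t0 // csym ci.
have [a0|a0] := eqVneq a 0.
  by exists i; rewrite eqxx a0 raddf0 oner_eq0.
exists j; rewrite (negPf ji); apply/eqP => /matrixP/(_ 0 0).
by rewrite !mxE /= => /esym/eqP; apply/negP.
Qed.

(* Transporting [z] from the centre [i] to [x] along the edge [t i x]; the
   commutation hypothesis is the holonomy condition for triangles through [i]. *)
Lemma star_commutant d (t : 'I_d -> 'I_d -> 'M[C]_2) c i (z : 'M[C]_2) :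
  quaternionic_tiles t c -> (forall x, x != i -> c i x != 0) ->
  (forall a, z != a%:M) ->
  (forall x y, x != i -> y != i -> x != y ->
     z *m (t i x *m t x y *m t y i) = (t i x *m t x y *m t y i) *m z) ->
  nonscalar_commutant t.
Proof.
move=> [tD tt csym t0] ci zN zt.
exists (fun x => if x == i then z else (c i x)^-1 *: (t x i *m z *m t i x)).
split=> [x y|a]; last by exists i; rewrite eqxx.
have [->|xi] := eqVneq x i; have [->|yi] := eqVneq y i.
- by have [a ->] := tD i; rewrite scalar_mxC.
- rewrite -scalemxAr !mulmxA tt mul_scalar_mx -scalemxAl scalerA.
  by rewrite mulVf ?ci // scale1r.
- rewrite -scalemxAl -mulmxA tt mul_mx_scalar scalerA.
  by rewrite mulVf ?ci // scale1r.
have [<-|xy] := eqVneq x y; first by have [a ->] := tD x; rewrite scalar_mxC.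
(* The holonomy condition is multiplied by [t x i] on the left and [t i y] on the right, and the
   products of mirror tiles collapse to scalars. *)
have loop : c i y *: (t x i *m z *m t i x *m t x y) =
            c i x *: (t x y *m (t y i *m z *m t i y)).
  rewrite csym -mul_mx_scalar -tt !mulmxA.
  have := congr1 (fun M => t x i *m M *m t i y) (zt _ _ xi yi xy).
  by rewrite /= !mulmxA => ->; rewrite tt csym mul_scalar_mx -!scalemxAl.
rewrite -scalemxAl -scalemxAr; apply: (scalerI (ci _ yi)).
by rewrite scalerA mulrC -scalerA loop !scalerA mulVf ?mulfV ?ci // !scale1r.
Qed.

(** View the nonzero [c x y] with [x != y] as edges of a graph. On at most three vertices, either
    some vertex is joined to all others and is the centre of a star, or, for two or three vertices,
    some vertex is isolated. *)
Lemma exists_nonscalar_commutant d (t : 'I_d -> 'I_d -> 'M[C]_2) c :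
  (0 < d <= 3)%N -> quaternionic_tiles t c -> nonscalar_commutant t.
Proof.
move=> /andP[d0 d3] tC; have [tD tt csym t0] := tC.
have E11 : exists z : 'M[C]_2, forall a, z != a%:M.
  by have [z [_ _ zN]] := @commuting_pair_commutant2 0 0 erefl; exists z.
case: d d0 d3 t c tC tD tt csym t0 => [//|[|[|[|//]]]] _ _ t c tC tD tt csym t0.
- have [z zN] := E11; apply: (star_commutant (i := 0) tC _ zN) => x.
    by rewrite !ord1.
  by move=> y; rewrite !ord1.
- have [c01|c01] := eqVneq (c 0 1) 0.
    apply: (isolated_commutant (i := 0) (j := 1) tC) => // -[[|[|//]]] i //= _.
    by rewrite -[RHS]c01; congr c; apply: val_inj.
  have [z zN] := E11; apply: (star_commutant (i := 0) tC _ zN).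
    move=> -[[|[|//]]] i //= _.
    by apply: contraNneq c01 => <-; apply/eqP; congr c; apply: val_inj.
  by move=> [[|[|//]]] i [[|[|//]]] j.
pose o0 : 'I_3 := 0; pose o1 : 'I_3 := 1; pose o2 : 'I_3 := lift 0 (lift 0 0).
have center i j k : [/\ i != j, i != k & j != k] ->
    (forall x, [|| x == i, x == j | x == k]) -> c i j != 0 -> c i k != 0 ->
    nonscalar_commutant t.
  move=> [ij ik jk] all_ijk cij cik.
  (* These are the holonomies of the triangle in its two orientations; both products collapse to the
     scalar [c i j * c j k * c k i], so they commute. *)
  pose m := t i j *m t j k *m t k i; pose m' := t i k *m t k j *m t j i.
  have mm' : m *m m' = m' *m m.
    rewrite /m /m' !mulmxA -[_ *m t k i *m t i k]mulmxA tt.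
    rewrite -[_ *m t j i *m t i j]mulmxA tt !mul_mx_scalar -!scalemxAl.
    rewrite -[_ *m t j k *m t k j]mulmxA -[_ *m t k j *m t j k]mulmxA !tt.
    rewrite !mul_mx_scalar -!scalemxAl !tt !scale_scalar_mx.
    by rewrite (csym k i) (csym k j) (csym j i); congr _%:M; ring.
  have [z [zm zm' zN]] := commuting_pair_commutant2 mm'.
  apply: (star_commutant (i := i) tC _ zN).
    move=> x xi; have := all_ijk x; rewrite (negPf xi) /=.
    by case/orP=> /eqP->.
  move=> x y xi yi xy; have := all_ijk x; have := all_ijk y.
  rewrite (negPf xi) (negPf yi) /= => /orP[]/eqP yE /orP[]/eqP xE; move: xy;
    by rewrite xE yE ?eqxx.
have isolated i j k : j != i ->
    (forall x, [|| x == i, x == j | x == k]) -> c i j = 0 -> c i k = 0 ->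
    nonscalar_commutant t.
  move=> ij all_ijk cij cik; apply: (isolated_commutant (i := i) tC ij) => x xi.
  by have := all_ijk x; rewrite (negPf xi) /= => /orP[]/eqP->.
have [c01|c01] := eqVneq (c o0 o1) 0; have [c02|c02] := eqVneq (c o0 o2) 0.
- by apply: (isolated o0 o1 o2) => // -[[|[|[|//]]]].
- have [c12|c12] := eqVneq (c o1 o2) 0.
    by apply: (isolated o1 o0 o2); rewrite ?[c o1 o0]csym // => -[[|[|[|//]]]].
  by apply: (center o2 o0 o1); rewrite ?[c o2 _]csym // => -[[|[|[|//]]]].
- have [c12|c12] := eqVneq (c o1 o2) 0.
    by apply: (isolated o2 o0 o1); rewrite ?[c o2 _]csym // => -[[|[|[|//]]]].
  by apply: (center o1 o0 o2); rewrite ?[c o1 o0]csym // => -[[|[|[|//]]]].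
- by apply: (center o0 o1 o2) => // -[[|[|[|//]]]].
Qed.

(** Pairing index [x] of the first half with index [x] of the second half cuts [block_mx A B D A^T]
    into 2 x 2 tiles; the transposed corner explains [A y x]. *)
Definition tile d (A B D : 'M[C]_d) (x y : 'I_d) : 'M[C]_2 :=
  \matrix_(a, b) if a == 0 then if b == 0 then A x y else B x y
                 else if b == 0 then D x y else A y x.

Definition tile_diag_mx d (q : 'I_d -> 'M[C]_2) : 'M[C]_(d + d) :=
  let e a b := diag_mx (\row_x q x a b) in
  block_mx (e 0 0) (e 0 (lift 0 0)) (e (lift 0 0) 0) (e (lift 0 0) (lift 0 0)).

Lemma tile_diag_mx_comm d (A B D : 'M[C]_d) (q : 'I_d -> 'M[C]_2) :
  (forall x y, q x *m tile A B D x y = tile A B D x y *m q y) ->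
  tile_diag_mx q *m block_mx A B D A^T = block_mx A B D A^T *m tile_diag_mx q.
Proof.
move=> qt; have qtE x y a b := congr1 (fun M : 'M_2 => M a b) (qt x y).
rewrite !mulmx_block; congr block_mx; apply/matrixP => x y;
  rewrite !mul_diag_mx !mul_mx_diag !mxE.
- by have := qtE x y 0 0; rewrite /= !mxE !big_ord_recl
    !big_ord0 !mxE /= !addr0.
- by have := qtE x y 0 (lift 0 0); rewrite /= !mxE !big_ord_recl
    !big_ord0 !mxE /= !addr0.
- by have := qtE x y (lift 0 0) 0; rewrite /= !mxE !big_ord_recl
    !big_ord0 !mxE /= !addr0.
by have := qtE x y (lift 0 0) (lift 0 0); rewrite /= !mxE !big_ord_recl
    !big_ord0 !mxE /= !addr0.
Qed.

Lemma tile_diag_mx_scalar d (q : 'I_d -> 'M[C]_2) c :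
  tile_diag_mx q = c%:M -> forall x, q x = c%:M.
Proof.
rewrite scalar_mx_block => /eq_block_mx[q00 q01 q10 q11] x.
have qE (M N : 'M[C]_d) : M = N -> M x x = N x x by move->.
apply/matrixP => a b; case: (ord2P a) => ->; case: (ord2P b) => ->.
- by have := qE _ _ q00; rewrite !mxE eqxx !mulr1n.
- by have := qE _ _ q01; rewrite !mxE eqxx !mulr1n.
- by have := qE _ _ q10; rewrite !mxE eqxx !mulr1n.
by have := qE _ _ q11; rewrite !mxE eqxx !mulr1n.
Qed.

Lemma skew_symmetricE d (B : 'M[C]_d) x y : B^T = - B -> B y x = - B x y.
Proof. by move/matrixP=> /(_ x y); rewrite !mxE. Qed.

Lemma skew_symmetric_diag d (B : 'M[C]_d) x : B^T = - B -> B x x = 0.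
Proof.
move=> /(@skew_symmetricE _ _ x x)/eqP.
by rewrite -addr_eq0 -mulr2n -mulr_natr mulf_eq0 pnatr_eq0 orbF => /eqP.
Qed.

(** For [n < 8] there are at most three tiles per row, so a nonscalar tile-diagonal matrix commutes
    with the normal form. It also commutes with the adjoint, against Schur. *)
Lemma irreducible_transposableN1_size n (T : 'M[C]_n) :
  irreducible_mx T -> transposable (-1) T -> (8 <= n)%N.
Proof.
move=> irrT /transposableN1_normal_form[d [A [B [D [Bs Ds TS BD AA]]]]].
have irrS := irreducible_equiv (equivmx_sym TS) irrT.
have [n0 _] := irrT; have [nd _] := TS.
rewrite leqNgt; apply/negP => n8.
have d_le3 : (0 < d <= 3)%N by lia.
have BE x y : B x y = (D x y)^*.
  have := congr1 (fun M : 'M_d => M x y) BD; rewrite !mxE.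
  by rewrite (skew_symmetricE _ _ Ds) rmorphN /= => /eqP; rewrite subr_eq0 => /eqP.
have AE x y : x != y -> A y x = - (A x y)^*.
  by rewrite eq_sym => /AA/eqP; rewrite addr_eq0 => /eqP.
(* This is the determinant of the tile at [(x, y)]; skewness of [B] and [D] makes the tile at
   [(y, x)] its adjugate. *)
pose c x y := A x y * A y x - B x y * D x y.
have tC : quaternionic_tiles (tile A B D) c.
  split=> [x|x y|x y|x y xy].
  - exists (A x x); apply/matrixP => -[[|[|//]]] i [[|[|//]]] j; rewrite !mxE //=.
      by rewrite (skew_symmetric_diag _ Bs).
    by rewrite (skew_symmetric_diag _ Ds).
  - have Byx := skew_symmetricE x y Bs; have Dyx := skew_symmetricE x y Ds.
    apply/matrixP => -[[|[|//]]] i [[|[|//]]] j;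
      rewrite !mxE !big_ord_recl !big_ord0 !mxE //= ?Byx ?Dyx;
      rewrite /c ?mulr1n ?mulr0n; ring.
  - by rewrite /c (skew_symmetricE x y Bs) (skew_symmetricE x y Ds) mulrNN mulrC.
  (* Off the diagonal the determinant is minus a sum of squared moduli, so it vanishes only with the
     whole tile. *)
  have -> : c x y = - (A x y * (A x y)^* + D x y * (D x y)^*).
    by rewrite /c BE (AE x y xy); ring.
  move/eqP; rewrite oppr_eq0 paddr_eq0 ?mul_conjC_ge0 //.
  rewrite !mul_conjC_eq0 => /andP[/eqP A0 /eqP D0].
  apply/matrixP => a b; rewrite !mxE BE (AE x y xy) A0 D0 conjC0 oppr0.
  by case: ifP; case: ifP.
have [q [qt qN]] := exists_nonscalar_commutant d_le3 tC.
have Xq : intertwines (tile_diag_mx q) (block_mx A B D A^T) (block_mx A B D A^T).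
  split; first by rewrite (tile_diag_mx_comm qt).
  rewrite adjmx_block.
  have -> : A^T^t* = (A^t*)^T by rewrite map_trmx.
  rewrite tile_diag_mx_comm // => x y.
  have [<-|xy] := eqVneq x y.
    suff -> : tile (A^t*) (D^t*) (B^t*) x x = (A x x)^*%:M by rewrite scalar_mxC.
    apply/matrixP => -[[|[|//]]] i [[|[|//]]] j; rewrite !mxE //=.
      by rewrite (skew_symmetric_diag _ Ds) conjC0.
    by rewrite (skew_symmetric_diag _ Bs) conjC0.
  (* The Hermitian part is diagonal, so passing to the adjoint merely negates the off-diagonal
     tiles. *)
  suff -> : tile (A^t*) (D^t*) (B^t*) x y = - tile A B D x y.
    by rewrite mulmxN mulNmx qt.
  apply/matrixP => -[[|[|//]]] i [[|[|//]]] j; rewrite !mxE //=.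
  - by rewrite (AE x y xy) rmorphN /= conjCK.
  - by rewrite (skew_symmetricE x y Ds) rmorphN /= BE.
  - by rewrite (skew_symmetricE x y Bs) rmorphN /= BE conjCK.
  - by rewrite (AE x y xy) opprK.
have [a Xa] := irreducible_intertwines_scalar irrS Xq.
by have [x /eqP] := qN a; apply; apply: tile_diag_mx_scalar.
Qed.

(** Once the Hermitian part is diagonal, the two off-diagonal entries have equal modulus, and a
    diagonal [G] with one phase [g] matches them. *)
Lemma UECSM_2 (T : 'M[C]_2) : UECSM T.
Proof.
apply/UECSM_transposable; pose H := T + T^t*.
have Hh : H^t* = H by rewrite adjmxD trmxCK addrC.
have /orthomx_spectralP : H \is normalmx by apply/normalmxP; rewrite Hh.
set P := spectralmx H; set s := spectral_diag H => HE.
have Pu : P \is unitarymx by exact: spectral_unitarymx.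
pose S := P *m T *m P^t*.
have SH : S + S^t* = diag_mx s.
  rewrite /S !adjmxM trmxCK mulmxA -mulmxDl -mulmxDr -/H HE invmx_unitary //.
  by rewrite !mulmxA (unitarymxP Pu) mul1mx mulmxtVK.
apply: (transposable_equiv (equivmx_sym (equivmx_conj T Pu erefl))).
rewrite -/S; clearbody S; pose k : 'I_2 := lift 0 0.
have S0k : S 0 k = - (S k 0)^*.
  have : (S + S^t*) 0 k = 0 by rewrite SH mxE.
  by rewrite mxE [S^t* _ _]mxE [S^T _ _]mxE => /eqP; rewrite addr_eq0 => /eqP.
have [g gg gS] : exists2 g : C, g * g^* = 1 & g * S k 0 = S 0 k.
  have [Sk0|Sk0] := eqVneq (S k 0) 0.
    by exists 1; rewrite ?conjC1 ?mulr1 // S0k Sk0 conjC0 oppr0 mulr0.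
  exists (S 0 k / S k 0); last by rewrite mulfVK.
  by rewrite -normCK S0k normf_div normrN norm_conjC divff ?expr1n ?normr_eq0.
exists (diag_mx (\row_i if i == 0 then 1 else g)); split.
- apply/unitarymxP; rewrite tr_diag_mx map_diag_mx mulmx_diag.
  apply/matrixP => i j; rewrite !mxE; case: (i =P j) => [->|//]; rewrite !mulr1n.
  by case: ifP => _; [rewrite rmorph1 mulr1|exact: gg].
- by rewrite tr_diag_mx scale1r.
apply/matrixP => i j; rewrite mul_diag_mx mul_mx_diag !mxE.
case: (ord2P i) => ->; case: (ord2P j) => ->; rewrite /= ?mul1r ?mulr1 //.
- by rewrite mulrC gS.
- by rewrite mulrC.
Qed.

End Tiles.

(** * Decomposition into types *)

Section Decomposition.
Variable C : numClosedFieldType.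

Lemma equivmx_mxdiag k (p q : 'I_k -> nat)
    (A : forall i, 'M[C]_(p i)) (B : forall i, 'M[C]_(q i)) :
  (forall i, equivmx (A i) (B i)) -> equivmx (\mxdiag_i A i) (\mxdiag_i B i).
Proof.
elim: k p q A B => [|k IHk] p q A B AB; first by apply: equivmx0; rewrite big_ord0.
rewrite !mxdiag_recl.
apply: (equivmx_trans (equivmx_castmx _ _)).
apply: equivmx_trans (equivmx_sym (equivmx_castmx _ _)).
by apply: equivmx_dsum; [exact: AB | exact: IHk].
Qed.

Lemma unitary_equiv_direct_sum_nil (P : forall m, 'M[C]_m -> Prop)
    n (T : 'M[C]_n) : n = 0%N -> unitary_equiv_direct_sum P T.
Proof.
move=> n0; have e : (\sum_(i < 0) 0 = n)%N by rewrite big_ord0 n0.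
exists 0%N, (fun=> 0%N), e, (fun=> 0); split; first by case.
by apply/unitary_equiv_castmx/equivmx0 => //; rewrite big_ord0.
Qed.

Lemma unitary_equiv_direct_sum_cons (P : forall m, 'M[C]_m -> Prop)
    m k n (A : 'M[C]_m) (B : 'M[C]_k) (T : 'M[C]_n) :
  P m A -> unitary_equiv_direct_sum P B -> equivmx T (A ⊕ B) ->
  unitary_equiv_direct_sum P T.
Proof.
move=> PA [l [p [e [D [PD /unitary_equiv_castmx BD]]]]] TAB.
(* Through [unlift ord0], a single case analysis on [option 'I_l] selects both the size and the
   block, which keeps the dependent types aligned. *)
pose p' (o : option 'I_l) := if o is Some j then p j else m.
pose D' (o : option 'I_l) : 'M[C]_(p' o) := if o is Some j then D j else A.
have TD : equivmx T (\mxdiag_(i < l.+1) D' (unlift ord0 i)).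
  apply: (equivmx_trans TAB); rewrite mxdiag_recl.
  apply: equivmx_trans (equivmx_sym (equivmx_castmx _ _)).
  apply: equivmx_dsum; first by rewrite unlift_none; exact: equivmx_refl.
  apply: (equivmx_trans BD); apply: equivmx_mxdiag => i.
  by rewrite liftK; exact: equivmx_refl.
have eT : (\sum_(i < l.+1) p' (unlift ord0 i))%N = n by case: TD.
exists l.+1, (fun i => p' (unlift ord0 i)), eT, (fun i => D' (unlift ord0 i)).
split; last exact/unitary_equiv_castmx.
by move=> i; case: (unlift ord0 i).
Qed.

Lemma complex_symmetric_transposable n (T : 'M[C]_n) :
  complex_symmetric T -> transposable 1 T.
Proof.
move=> Ts; apply/UECSM_transposable; exists T => //.
exact/unitary_equivE/equivmx_refl.
Qed.

Lemma typeIII_equiv n (T : 'M[C]_n) : typeIII T ->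
  exists d (A : 'M[C]_d),
    [/\ irreducible_mx A, ~ UECSM A, ~ UESHM A & equivmx T (A ⊕ A^T)].
Proof.
case=> d [e [A [irrA NA NA' ->]]]; exists d, A; split=> //.
exact: equivmx_castmx.
Qed.

(** Swapping the two summands transposes the matrix. *)
Lemma UET_dsum_tr d (A : 'M[C]_d) : UET (A ⊕ A^T).
Proof.
apply/UET_transposer; exists (block_mx 0 1%:M 1%:M 0).
  apply/unitarymxP; rewrite adjmx_block !adjmx0 adjmx1 mulmx_block.
  by rewrite !mulmx0 !mul0mx !mulmx1 !addr0 ?add0r -scalar_mx_block.
rewrite tr_block_mx !mulmx_block trmxK !trmx0.
by rewrite !mulmx0 !mul0mx !mulmx1 !mul1mx !addr0 ?add0r.
Qed.

Lemma typed_UET n (T : 'M[C]_n) : [\/ typeI T, typeII T | typeIII T] -> UET T.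
Proof.
case=> [[_ /complex_symmetric_transposable]|[_ /skew_hamiltonian_transposable]|].
- exact: transposable_UET.
- exact: transposable_UET.
by move/typeIII_equiv=> [d [A [_ _ _ TA]]]; exact: UET_equiv TA (UET_dsum_tr A).
Qed.

Lemma UET_direct_sum (P : forall m, 'M[C]_m -> Prop) n (T : 'M[C]_n) :
  (forall m (A : 'M[C]_m), P m A -> UET A) ->
  unitary_equiv_direct_sum P T -> UET T.
Proof.
move=> P_UET [k [p [e [B [PB /unitary_equiv_castmx TB]]]]].
apply: UET_equiv TB _; apply/unitary_equivE; rewrite tr_mxdiag.
by apply: equivmx_mxdiag => i; apply/unitary_equivE/P_UET.
Qed.

(** The induction on the size needs the remainder to be UET again; cancelling irreducible summands
    in the equivalence of [T] with [T^T] provides this. *)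
Lemma direct_sum_UET n (T : 'M[C]_n) : UET T ->
  unitary_equiv_direct_sum
    (fun m (S : 'M[C]_m) => [\/ typeI S, typeII S | typeIII S]) T.
Proof.
elim/ltn_ind: n T => n IHn T uT.
have [n0|n0] := posnP n; first exact: unitary_equiv_direct_sum_nil.
have [m [A [irrA AT]]] := exists_irreducible_summand T n0.
have [m0 _] := irrA; have [k [B TAB]] := summand_complement AT.
have nE : n = (m + k)%N by case: TAB.
have /unitary_equivE TT := uT.
have irrAt := irreducible_tr irrA.
have ABt : equivmx (A ⊕ B) (A^T ⊕ B^T).
  have -> : A^T ⊕ B^T = (A ⊕ B)^T by rewrite tr_block_mx !trmx0.
  apply: (equivmx_trans (equivmx_sym TAB)); apply: (equivmx_trans TT).
  exact: equivmx_tr.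
have [uA|NuA] := EM (UET A).
  have uB : UET B.
    apply/unitary_equivE/(irreducible_cancel irrA)/(equivmx_trans ABt).
    apply: equivmx_dsum (equivmx_refl _); apply/equivmx_sym.
    exact/unitary_equivE.
  have [S SA SP] : exists2 S : 'M[C]_m, equivmx A S &
      [\/ typeI S, typeII S | typeIII S].
    have [/UECSM_transposable|/UESHM_transposable] :=
      irreducible_transposable irrA uA.
      move=> [S Ss /unitary_equivE AS]; exists S => //; apply: Or31; split=> //.
      exact: irreducible_equiv (equivmx_sym AS) irrA.
    move=> [S Ss /unitary_equivE AS]; exists S => //; apply: Or32; split=> //.
    exact: irreducible_equiv (equivmx_sym AS) irrA.
  have ltkn : (k < n)%N by rewrite nE -[X in (X < _)%N]add0n ltn_add2r.
  apply: (unitary_equiv_direct_sum_cons SP (IHn k ltkn B uB)).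
  exact: equivmx_trans TAB (equivmx_dsum SA (equivmx_refl B)).
(* [A^T] is a summand of [A ⊕ B] and is not equivalent to [A], so it embeds in [B]. *)
have AtB : summand A^T B.
  apply: (irreducible_summand_dsum irrA irrAt) => [AtA|].
    by apply/NuA/unitary_equivE/equivmx_sym.
  apply: (summand_trans (summand_dsuml A^T B^T)).
  by case: (equivmx_sym ABt).
have [l [D BD]] := summand_complement AtB.
have kE : k = (m + l)%N by case: BD.
(* [A ⊕ (A^T ⊕ D)] is equivalent to [A^T ⊕ (A ⊕ D^T)]; after reordering, [A] and then [A^T]
   cancel. *)
have uD : UET D.
  apply/unitary_equivE/(irreducible_cancel irrAt)/(irreducible_cancel irrA).
  have BtD : equivmx B^T (A ⊕ D^T).
    have -> : A ⊕ D^T = (A^T ⊕ D)^T by rewrite tr_block_mx !trmx0 trmxK.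
    exact: equivmx_tr.
  apply: (equivmx_trans (equivmx_dsum (equivmx_refl A) (equivmx_sym BD))).
  apply: (equivmx_trans ABt).
  apply: (equivmx_trans (equivmx_dsum (equivmx_refl A^T) BtD)).
  exact: equivmx_dsumCA.
have TAAD : equivmx T ((A ⊕ A^T) ⊕ D).
  apply: (equivmx_trans TAB).
  apply: (equivmx_trans (equivmx_dsum (equivmx_refl A) BD)).
  exact: equivmx_dsumA.
have ltln : (l < n)%N.
  by rewrite nE kE addnA -[X in (X < _)%N]add0n ltn_add2r addn_gt0 m0.
apply: (unitary_equiv_direct_sum_cons _ (IHn l ltln D uD) TAAD).
apply: Or33; exists m, erefl, A; split; rewrite ?castmx_id //.
- by move=> /UECSM_transposable /transposable_UET.
- by move=> /UESHM_transposable /transposable_UET.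
Qed.

Lemma typeII_size n (T : 'M[C]_n) : typeII T -> (8 <= n)%N.
Proof.
move=> [irrT /skew_hamiltonian_transposable].
exact: irreducible_transposableN1_size.
Qed.

(** Sizes 1 and 2 are excluded for [A]: a 1 x 1 matrix is symmetric, and a 2 x 2 matrix is UECSM. *)
Lemma typeIII_size n (T : 'M[C]_n) : typeIII T -> (6 <= n)%N.
Proof.
move=> /typeIII_equiv[d [A [[d0 _] NA _ [nE _]]]]; rewrite nE => {nE}.
case: d d0 A NA => [//|[|[|d]]] _ A NA; last by rewrite !addSn !addnS.
  by case: NA; apply/UECSM_transposable/complex_symmetric_transposable;
    apply/matrixP => i j; rewrite mxE !ord1.
by case: NA; exact: UECSM_2.
Qed.

(** The summand [A] has half the size of [T]; this separates type (III) from the two irreducible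
    types. *)
Lemma typeIII_reducible n (T : 'M[C]_n) : typeIII T -> ~ irreducible_mx T.
Proof.
move=> /typeIII_equiv[d [A [[d0 _] _ _ TA]]] /irreducible_mxP[_ irrT].
have AT : summand A T.
  by apply: summand_trans (summand_dsuml A A^T) _; case: (equivmx_sym TA).
have := irrT _ _ d0 AT; have [nE _] := TA; rewrite {1}nE => /eqP.
by rewrite -[X in X == _]addn0 eqn_add2l eq_sym eqn0Ngt d0.
Qed.

Lemma typeI_typeII_disjoint n (S T : 'M[C]_n) :
  typeI S -> typeII T -> ~ unitary_equiv S T.
Proof.
move=> [irrS /complex_symmetric_transposable S1].
move=> [_ /skew_hamiltonian_transposable T1] /unitary_equivE ST.
exact: irreducible_not_both irrS S1 (transposable_equiv ST T1).
Qed.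

Lemma irreducible_typeIII_disjoint n (S T : 'M[C]_n) :
  irreducible_mx S -> typeIII T -> ~ unitary_equiv S T.
Proof.
move=> irrS T3 /unitary_equivE ST.
exact: typeIII_reducible T3 (irreducible_equiv (equivmx_sym ST) irrS).
Qed.

End Decomposition.

(** * The classification over the complex numbers *)

Theorem theorem1p1 (R : realType) :
  [/\ (forall (n : nat) (T : 'M[R[i]]_n), (0 < n)%N ->
         (UET T <->
          unitary_equiv_direct_sum
            (fun m (S : 'M[R[i]]_m) => [\/ typeI S, typeII S | typeIII S]) T)),
      (forall (n : nat) (T : 'M[R[i]]_n), typeII T -> (8 <= n)%N),
      (forall (n : nat) (T : 'M[R[i]]_n), typeIII T -> (6 <= n)%N)
    & (forall (n : nat) (S T : 'M[R[i]]_n),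
         [/\ typeI S -> typeII T -> ~ unitary_equiv S T,
             typeI S -> typeIII T -> ~ unitary_equiv S T
           & typeII S -> typeIII T -> ~ unitary_equiv S T])].
Proof.
split.
- move=> n T _; split; first exact: direct_sum_UET.
  by apply: UET_direct_sum => m A; exact: typed_UET.
- by move=> n T; exact: typeII_size.
- by move=> n T; exact: typeIII_size.
- move=> n S T; split; first exact: typeI_typeII_disjoint.
  + by move=> [irrS _]; exact: irreducible_typeIII_disjoint.
  + by move=> [irrS _]; exact: irreducible_typeIII_disjoint.
Qed.
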